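(* For no constant $\varepsilon>0$ does there exist a $\left(\frac{\sqrt5+1}{2}-\varepsilon\right)$-competitive online algorithm for $1|jrp,s=1,p_j=1,r_j|F_{\max}+c_\mathcal{Q}$.
   Context: Problem $1|jrp,s=1,p_j=1,r_j|F_{\max}+c_\mathcal{Q}$: jobs with processing time $1$ and nonnegative integer release dates $r_j$ (several jobs may share a release date) must be processed non-preemptively on a single machine (at most one job at a time). There is a single resource, required by every job; each replenishment of it costs $K:=K_0+K_1\ge0$ (part of the instance). A solution consists of start times $S_j$ (completion times $C_j=S_j+1$) and replenishment times $t_1<\dots<t_q$; it is feasible if no two jobs overlap and for each job $j$ some replenishment time lies in $[r_j,S_j]$. Its cost is $\max_j(C_j-r_j)+qK$. Online setting: jobs are not known in advance (neither their number nor their data); a job becomes known at its release date, and replenishment and scheduling decisions cannot be revoked. An online algorithm is $c$-competitive if on every instance its cost is at most $c$ times the optimal offline cost. *)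

(* Defs.v *)
From HB Require Import structures.
From mathcomp Require Import all_boot all_order all_algebra.
From mathcomp Require Import mathcomp_extra boolp classical_sets reals.

Set Implicit Arguments.
Unset Strict Implicit.
Unset Printing Implicit Defensive.

Import Order.TTheory GRing.Theory Num.Theory.

Local Open Scope classical_set_scope.
Local Open Scope ring_scope.

(* The jobs are numbered in nondecreasing order of their release dates, so that
   the number of a job carries no information about jobs released later. *)
Record instance (R : realType) := Instance {
  repl_cost : R;
  release_dates : seq nat;
  repl_cost_ge0 : 0 <= repl_cost;
  release_dates_sorted : sorted leq release_dates;
  release_dates_neq0 : release_dates != [::]
}.

Definition njobs (R : realType) (I : instance R) : nat :=
  size (release_dates I).

Definition release (R : realType) (I : instance R) (j : 'I_(njobs I)) : R :=
  (nth 0%N (release_dates I) j)%:R.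

(* Times are real numbers, for the online algorithm and for the offline
   optimum alike. *)
Record schedule (R : realType) (n : nat) := Schedule {
  start : 'I_n -> R;
  repl_times : seq R
}.

Definition completion (R : realType) (n : nat) (s : schedule R n) (j : 'I_n) : R :=
  start s j + 1.

Definition feasible (R : realType) (I : instance R) (s : schedule R (njobs I)) : Prop :=
  [/\ sorted (fun t u : R => t < u) (repl_times s),
      forall j k : 'I_(njobs I), j != k ->
        completion s j <= start s k \/ completion s k <= start s j
    & forall j : 'I_(njobs I),
        exists2 t, t \in repl_times s & release j <= t <= start s j].

(* The default value 0 of the maximum is harmless: there is at least one job,
   and in a feasible schedule every flow time is at least 1. *)
Definition Fmax (R : realType) (I : instance R) (s : schedule R (njobs I)) : R :=
  \big[Num.max/0]_(j < njobs I) (completion s j - release j).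

Definition cost (R : realType) (I : instance R) (s : schedule R (njobs I)) : R :=
  Fmax s + (size (repl_times s))%:R * repl_cost I.

Definition opt_cost (R : realType) (I : instance R) : R :=
  inf [set cost s | s in @feasible R I].

Definition algorithm (R : realType) : Type :=
  forall I : instance R, schedule R (njobs I).

Definition known_at (R : realType) (I : instance R) (t : R) : seq nat :=
  [seq r <- release_dates I | r%:R <= t].

(* Two instances that cannot be told apart at time t receive the same
   irrevocable decisions up to time t, those of time t included. *)
Definition nonanticipating (R : realType) (A : algorithm R) : Prop :=
  forall (I I' : instance R) (t : R),
    repl_cost I = repl_cost I' -> known_at I t = known_at I' t ->
    (forall u : R, u <= t ->
       (u \in repl_times (A I)) = (u \in repl_times (A I'))) /\
    (forall (j : 'I_(njobs I)) (j' : 'I_(njobs I')), j = j' :> nat ->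
       start (A I) j <= t -> start (A I') j' = start (A I) j).

Definition online_algorithm (R : realType) (A : algorithm R) : Prop :=
  (forall I : instance R, feasible (A I)) /\ nonanticipating A.

Definition competitive (R : realType) (c : R) (A : algorithm R) : Prop :=
  forall I : instance R, cost (A I) <= c * opt_cost I.

(* Main.v *)
(** Take a large replenishment cost [K] and release one job at time 0. If the
    algorithm starts it at time [s], its cost is at least [s + 1 + K], against
    an optimum of [1 + K]. Otherwise release a second job at the first integer
    [r > s]: the algorithm must replenish again and pays at least
    [s + 1 + 2K], while replenishing once, at time [r], costs at most
    [s + 2 + K]. A ratio [c] achieved on both instances satisfies
    [K (1 + c - c^2) <= c^2], which fails for large [K] if [c] is below the
    golden ratio. *)
Require Import Defs.
From HB Require Import structures.
From mathcomp Require Import all_boot all_order all_algebra.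
From mathcomp Require Import mathcomp_extra boolp classical_sets reals.
From mathcomp Require Import ring lra.

Import Order.TTheory GRing.Theory Num.Theory.

Local Open Scope ring_scope.

Lemma flow_le_Fmax (R : realType) (I : instance R) (s : schedule R (njobs I))
  (j : 'I_(njobs I)) : completion s j - release j <= Fmax s.
Proof. exact: le_bigmax. Qed.

Lemma Fmax_ge0 (R : realType) (I : instance R) (s : schedule R (njobs I)) :
  0 <= Fmax s.
Proof. exact: bigmax_ge_id. Qed.

Lemma cost_ge0 (R : realType) (I : instance R) (s : schedule R (njobs I)) :
  0 <= cost s.
Proof. by rewrite addr_ge0 ?Fmax_ge0 ?mulr_ge0 ?repl_cost_ge0. Qed.

Lemma opt_cost_le (R : realType) (I : instance R) (s : schedule R (njobs I)) :
  feasible s -> opt_cost I <= cost s.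
Proof.
move=> fs; apply: ge_inf; last by exists s.
by exists 0 => _ [s' _ <-]; exact: cost_ge0.
Qed.

Lemma opt_cost_ge0 (R : realType) (I : instance R) (s : schedule R (njobs I)) :
  feasible s -> 0 <= opt_cost I.
Proof.
move=> fs; apply: lb_le_inf; first by exists (cost s), s.
by move=> _ [s' _ <-]; exact: cost_ge0.
Qed.

Lemma competitive_le_cost (R : realType) (c : R) (A : algorithm R)
  (I : instance R) (s : schedule R (njobs I)) :
  0 <= c -> competitive c A -> feasible s -> cost (A I) <= c * cost s.
Proof.
move=> c0 cA fs; apply: (le_trans (cA I)).
by rewrite ler_wpM2l ?opt_cost_le.
Qed.

Definition one_job (R : realType) (K : R) (K0 : 0 <= K) : instance R :=
  @Instance R K [:: 0%N] K0 isT isT.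

Definition two_jobs (R : realType) (K : R) (r : nat) (K0 : 0 <= K) :
  instance R := @Instance R K [:: 0%N; r] K0 isT isT.

Lemma one_job_schedule (R : realType) (K : R) (K0 : 0 <= K) :
  exists2 s : schedule R (njobs (one_job R K K0)),
    feasible s & cost s = 1 + K.
Proof.
exists (@Schedule R (njobs (one_job R K K0)) (fun=> 0) [:: 0]).
  split => //= [j k|j]; first by rewrite !ord1 eqxx.
  by exists 0; rewrite ?mem_head // /release ord1 lexx.
rewrite /cost /Fmax /njobs /= big_ord_recl big_ord0 /completion /release /=.
by rewrite add0r subr0 mul1r max_l.
Qed.

(** Both jobs run back to back from time [r], after a single replenishment at [r]. Their flow times
    are [r + 1] and [2], and the first is the maximum because [r] is at least 1. *)
Lemma two_jobs_schedule (R : realType) (K : R) (r : nat) (K0 : 0 <= K) :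
  (0 < r)%N ->
  exists2 s : schedule R (njobs (two_jobs R K r K0)),
    feasible s & cost s = r%:R + 1 + K.
Proof.
move=> r0; have r1 : 1 <= r%:R :> R by rewrite ler1n.
exists (@Schedule R (njobs (two_jobs R K r K0))
  (fun j => r%:R + (j : nat)%:R) [:: r%:R]).
  split => //= [[[|[|//]] ?] [[|[|//]] ?]|[[|[|//]] ?]];
    rewrite /completion ?eqxx //=.
  - by left; rewrite addr0.
  - by right; rewrite addr0.
  - by exists r%:R; rewrite ?mem_head // /release /= addr0 ler0n lexx.
  - by exists r%:R; rewrite ?mem_head // /release /= lexx lerDl ler01.
rewrite /cost /Fmax /njobs /= !big_ord_recl big_ord0 /completion /release /=.
rewrite mul1r (_ : r%:R + _ + 1 - r%:R = 2 :> R); last by rewrite /bump /=; ring.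
by rewrite (max_l (ler0n _ 2)) addr0 subr0 max_l //; lra.
Qed.

Lemma size_ge2 (T : eqType) (s : seq T) (x y : T) :
  x \in s -> y \in s -> x != y -> (2 <= size s)%N.
Proof.
case: s => [|a [|b s]] //; rewrite !inE => /eqP-> /eqP->.
by rewrite eqxx.
Qed.

Section AgainstOnline.
Context {R : realType} {A : algorithm R} (K : R) (K0 : 0 <= K)
  (onA : online_algorithm A).

Let I1 := one_job R K K0.
Let s := start (A I1) (ord0 : 'I_1).

Lemma one_job_start_ge0 : 0 <= s.
Proof.
have [[_ _ /(_ (ord0 : 'I_1))]] := onA.1 I1.
by move=> [t _ /andP[]]; exact: le_trans.
Qed.

Lemma one_job_cost_ge : s + 1 + K <= cost (A I1).
Proof.
have [_ _ /(_ (ord0 : 'I_1)) [t tA _]] := onA.1 I1.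
have := flow_le_Fmax R I1 (A I1) (ord0 : 'I_1).
rewrite /completion /release /= subr0 -/s => sF.
apply: lerD => //=; rewrite ler_peMl // ler1n.
by case: repl_times tA.
Qed.

(** At time [s] the second job is still unknown, so job 0 starts at [s] here too. Its replenishment
    is at most [s], hence before [r], and cannot be the one serving the second job. *)
Lemma two_jobs_cost_ge (r : nat) :
  s < r%:R -> s + 1 + 2 * K <= cost (A (two_jobs R K r K0)).
Proof.
move=> sr; set I2 := two_jobs R K r K0.
have same_known : known_at I1 s = known_at I2 s.
  by rewrite /known_at /= [r%:R <= s]leNgt sr.
have [_ /(_ (ord0 : 'I_1) (ord0 : 'I_2) erefl (lexx _))] :=
  onA.2 I1 I2 s erefl same_known.
rewrite -/s => start2.
have [_ _ fI2] := onA.1 I2.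
have [t tA] := fI2 (ord0 : 'I_2).
rewrite start2 => /andP[_ ts].
have [u uA /andP[ru _]] := fI2 (ord_max : 'I_2).
have := flow_le_Fmax R I2 (A I2) (ord0 : 'I_2).
rewrite /completion /release /= subr0 start2 => sF.
apply: lerD => //=; rewrite ler_wpM2r // ler_nat.
apply: (size_ge2 _ _ _ _ tA uA).
by rewrite lt_eqF // (le_lt_trans ts) // (lt_le_trans sr).
Qed.

(** The optimum is nonnegative while the algorithm pays at least 1. Positivity of [c] is what allows
    upper bounds on the optimum to be multiplied by [c]. *)
Lemma competitive_gt0 (c : R) : competitive c A -> 0 < c.
Proof.
move=> /(_ I1) cA; have opt0 := opt_cost_ge0 R I1 _ (onA.1 I1).
rewrite ltNge; apply/negP => c0.
have := le_trans one_job_cost_ge (le_trans cA (mulr_le0_ge0 c0 opt0)).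
have := one_job_start_ge0; move: K0; lra.
Qed.

Lemma competitive_repl_cost_le (c : R) :
  competitive c A -> 1 <= c /\ K * (1 + c - c ^+ 2) <= c ^+ 2.
Proof.
move=> cA; have c0 := competitive_gt0 _ cA; have s0 := one_job_start_ge0.
have [s1 fs1 cs1] := one_job_schedule R K K0.
have := competitive_le_cost R c A I1 s1 (ltW c0) cA fs1; rewrite cs1.
move/(le_trans one_job_cost_ge) => h1.
(* The least integer above [s]: strictly larger, so that the second job is unknown at [s], yet at
   most [s + 1]. *)
have /andP[lr rl] := truncn_itv s0; set r := (Num.truncn s).+1.
have [s2 fs2 cs2] := two_jobs_schedule R K r K0 isT.
have := competitive_le_cost R c A _ s2 (ltW c0) cA fs2; rewrite cs2.
move/(le_trans (two_jobs_cost_ge r rl)) => h2.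
have rs : r%:R <= s + 1 by rewrite /r -natr1 lerD2r.
have h3 : c * (r%:R + 1 + K) <= c * (s + 2 + K) by rewrite ler_pM2l //; lra.
have c1 : 1 <= c by rewrite -(ler_pM2r (_ : 0 < 1 + K)); move: K0; lra.
(* Adding [c - 1] times [h1] to the chain of [h2] and [h3] cancels [s]. *)
split=> //; have := ler_wpM2l (_ : 0 <= c - 1) h1; rewrite subr_ge0 => /(_ c1).
lra.
Qed.

End AgainstOnline.

Theorem theorem17 (R : realType) (eps : R) (heps : 0 < eps) :
  ~ exists A : algorithm R,
      online_algorithm A /\ competitive ((Num.sqrt 5 + 1) / 2 - eps) A.
Proof.
move=> [A [onA]]; set c := _ - eps => cA.
(* Cost 0 serves only to obtain [1 <= c], which forces [eps < Num.sqrt 5] below. *)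
have [c1 _] := competitive_repl_cost_le 0 (lexx 0) onA _ cA.
have d0 : 0 < 1 + c - c ^+ 2.
  have q0 : 0 <= Num.sqrt 5 :> R := sqrtr_ge0 5.
  have q5 : Num.sqrt 5 ^+ 2 = 5 :> R by rewrite sqr_sqrtr.
  have -> : 1 + c - c ^+ 2 = eps * (Num.sqrt 5 - eps).
    (* The extra term is zero; it makes the identity hold with [Num.sqrt 5] treated as an
       indeterminate, as [field] requires. *)
    transitivity (eps * (Num.sqrt 5 - eps) + (5 - Num.sqrt 5 ^+ 2) / 4).
      by rewrite /c; field.
    by rewrite q5 subrr mul0r addr0.
  by rewrite mulr_gt0 //; rewrite /c in c1; nra.
(* For this replenishment cost, multiplying by [1 + c - c ^+ 2] gives [c ^+ 2] plus a positive
   amount. *)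
have K0 : 0 <= c ^+ 2 / (1 + c - c ^+ 2) + 1.
  by rewrite addr_ge0 // divr_ge0 ?sqr_ge0 // ltW.
have [_] := competitive_repl_cost_le _ K0 onA _ cA.
by rewrite mulrDl mul1r divfK ?gt_eqF // gerDl leNgt d0.
Qed.
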